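(* Let $\mathcal{C}$ be a triangulated category. For any cotorsion pair $(\mathcal{U},\mathcal{V})$ in $\mathcal{C}$, its heart $$\underline{\mathcal{H}}=(\mathcal{C}^+\cap\mathcal{C}^-)/(\mathcal{U}\cap\mathcal{V})$$ is an abelian category.
   Context: $\mathcal{C}$ is a triangulated category with shift functor $[1]$; $\mathcal{C}(A,B)$ is the set of morphisms and $\mathrm{Ext}^{1}(A,B)=\mathcal{C}(A,B[1])$. For full subcategories $\mathcal{M},\mathcal{N}$, $\mathrm{Ext}^1(\mathcal{M},\mathcal{N})=0$ means $\mathrm{Ext}^1(M,N)=0$ for all $M\in\mathcal{M}$, $N\in\mathcal{N}$. A ''full additive thick subcategory'' is a full subcategory containing $0$ and closed under isomorphisms, finite direct sums and direct summands (it is not required to be closed under shifts or cones). A pair $(\mathcal{U},\mathcal{V})$ of full additive thick subcategories of $\mathcal{C}$ is a cotorsion pair if (1) $\mathrm{Ext}^1(\mathcal{U},\mathcal{V})=0$, and (2) for any $C\in\mathcal{C}$ there is a (not necessarily unique) distinguished triangle $U\to C\to V[1]\to U[1]$ with $U\in\mathcal{U}$, $V\in\mathcal{V}$. Put $\mathcal{W}=\mathcal{U}\cap\mathcal{V}$. The quotient category $\underline{\mathcal{C}}=\mathcal{C}/\mathcal{W}$ has the same objects as $\mathcal{C}$, and $\underline{\mathcal{C}}(A,B)$ is $\mathcal{C}(A,B)$ modulo the morphisms factoring through some object of $\mathcal{W}$. $\mathcal{C}^+$ is the full subcategory of those $C\in\mathcal{C}$ for which there is a distinguished triangle $W_0\to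 C\to V_0[1]\to W_0[1]$ with $W_0\in\mathcal{W}$, $V_0\in\mathcal{V}$ (equivalently, every distinguished triangle $U\to C\to V[1]\to U[1]$ with $U\in\mathcal{U}$, $V\in\mathcal{V}$ has $U\in\mathcal{W}$). $\mathcal{C}^-$ is the full subcategory of those $C\in\mathcal{C}$ for which there is a distinguished triangle $U_0[-1]\to C\to W_0\to U_0$ with $U_0\in\mathcal{U}$, $W_0\in\mathcal{W}$ (equivalently, every distinguished triangle $U[-1]\to C\to V\to U$ with $U\in\mathcal{U}$, $V\in\mathcal{V}$ has $V\in\mathcal{W}$). Put $\mathcal{H}=\mathcal{C}^+\cap\mathcal{C}^-$, which contains $\mathcal{W}$; the heart $\underline{\mathcal{H}}=\mathcal{H}/\mathcal{W}$ is the full subcategory of $\underline{\mathcal{C}}$ on the objects of $\mathcal{H}$. *)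

(* Defs.v *)
From HB Require Import structures.
From mathcomp Require Import all_boot all_algebra.
From mathcomp Require Import boolp classical_sets.

Set Implicit Arguments.
Unset Strict Implicit.
Unset Printing Implicit Defensive.

Import GRing.Theory.

Local Open Scope classical_set_scope.
Local Open Scope ring_scope.

Declare Scope cat_scope.
Delimit Scope cat_scope with cat.
Local Open Scope cat_scope.

#[local] Obligation Tactic := idtac.

Reserved Notation "A ~> B" (at level 80, B at next level, no associativity).
Reserved Notation "g \oc f" (at level 40, left associativity).

(* In presence of [boolp], every abelian group is a [zmodType]: the decidable
   equality and the choice operator carried by [zmodType] are no restriction. *)
Record preadditiveCat := PreadditiveCat {
  obj :> Type;
  hom : obj -> obj -> zmodType;
  idm : forall A, hom A A;
  compm : forall A B C, hom B C -> hom A B -> hom A C;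
  comp1m : forall A B (f : hom A B), compm (idm B) f = f;
  compm1 : forall A B (f : hom A B), compm f (idm A) = f;
  compmA : forall A B C D (h : hom C D) (g : hom B C) (f : hom A B),
    compm h (compm g f) = compm (compm h g) f;
  compmDl : forall A B C (g1 g2 : hom B C) (f : hom A B),
    compm (g1 + g2) f = compm g1 f + compm g2 f;
  compmDr : forall A B C (g : hom B C) (f1 f2 : hom A B),
    compm g (f1 + f2) = compm g f1 + compm g f2
}.

Arguments hom {_} _ _.
Arguments idm {_} _.
Arguments compm {_ _ _ _} _ _.

Notation "A ~> B" := (hom A B) : type_scope.
Notation "A ~> B" := (hom A B) : cat_scope.
Notation "g \oc f" := (compm g f) : cat_scope.

Section Notions.
Variable C : preadditiveCat.
Implicit Types A B P K Z T : C.

Definition is_iso A B (f : A ~> B) : Prop :=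
  exists g : B ~> A, g \oc f = idm A /\ f \oc g = idm B.

Definition is_zero Z : Prop :=
  forall T, (forall f : T ~> Z, f = 0) /\ (forall f : Z ~> T, f = 0).

Definition is_biproduct A B P : Prop :=
  exists (i1 : A ~> P) (i2 : B ~> P) (p1 : P ~> A) (p2 : P ~> B),
    [/\ p1 \oc i1 = idm A, p2 \oc i2 = idm B, p1 \oc i2 = 0, p2 \oc i1 = 0
      & i1 \oc p1 + i2 \oc p2 = idm P].

Definition is_mono A B (f : A ~> B) : Prop :=
  forall T (g h : T ~> A), f \oc g = f \oc h -> g = h.

Definition is_epi A B (f : A ~> B) : Prop :=
  forall T (g h : B ~> T), g \oc f = h \oc f -> g = h.

Definition is_kernel A B (f : A ~> B) K (k : K ~> A) : Prop :=
  f \oc k = 0 /\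
  forall T (g : T ~> A), f \oc g = 0 -> exists! h : T ~> K, k \oc h = g.

Definition is_cokernel A B (f : A ~> B) K (k : B ~> K) : Prop :=
  k \oc f = 0 /\
  forall T (g : B ~> T), g \oc f = 0 -> exists! h : K ~> T, h \oc k = g.

Record is_additive : Prop := IsAdditive {
  additive_zero : exists Z, is_zero Z;
  additive_biproduct : forall A B, exists P, is_biproduct A B P
}.

Record is_abelian : Prop := IsAbelian {
  abelian_additive :> is_additive;
  abelian_kernel : forall A B (f : A ~> B),
    exists K (k : K ~> A), is_kernel f k;
  abelian_cokernel : forall A B (f : A ~> B),
    exists K (k : B ~> K), is_cokernel f k;
  abelian_mono : forall A B (f : A ~> B), is_mono f ->
    exists D (g : B ~> D), is_kernel g f;
  abelian_epi : forall A B (f : A ~> B), is_epi f ->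
    exists D (g : D ~> A), is_cokernel g f
}.

End Notions.

Record additiveFunctor (C D : preadditiveCat) := AdditiveFunctor {
  fobj :> C -> D;
  fmap : forall A B : C, (A ~> B) -> (fobj A ~> fobj B);
  fmap1 : forall A : C, fmap (idm A) = idm (fobj A);
  fmapM : forall (A B E : C) (g : B ~> E) (f : A ~> B),
    fmap (g \oc f) = fmap g \oc fmap f;
  fmapD : forall (A B : C) (f g : A ~> B), fmap (f + g) = fmap f + fmap g
}.

Arguments fmap {C D} _ {A B} _.

(* The shift is an additive auto-equivalence with a chosen quasi-inverse; an
   automorphism is the case where the isomorphisms [shift_unit] and
   [shift_counit] come from equalities of objects.  *)
Record triangulatedCat := TriangulatedCat {
  tri_cat :> preadditiveCat;
  tri_additive : is_additive tri_cat;
  shift : additiveFunctor tri_cat tri_cat;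
  unshift : additiveFunctor tri_cat tri_cat;
  shift_unit : forall A : tri_cat, A ~> unshift (shift A);
  shift_unit_iso : forall A, is_iso (shift_unit A);
  shift_unit_nat : forall (A B : tri_cat) (f : A ~> B),
    fmap unshift (fmap shift f) \oc shift_unit A = shift_unit B \oc f;
  shift_counit : forall A : tri_cat, A ~> shift (unshift A);
  shift_counit_iso : forall A, is_iso (shift_counit A);
  shift_counit_nat : forall (A B : tri_cat) (f : A ~> B),
    fmap shift (fmap unshift f) \oc shift_counit A = shift_counit B \oc f;
  (* [dist u v w]: the triangle X -u-> Y -v-> Z -w-> X[1] is distinguished *)
  dist : forall X Y Z : tri_cat,
    (X ~> Y) -> (Y ~> Z) -> (Z ~> shift X) -> Prop;
  (* TR1 *)
  dist_iso : forall (X Y Z X' Y' Z' : tri_cat)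
      (u : X ~> Y) (v : Y ~> Z) (w : Z ~> shift X)
      (u' : X' ~> Y') (v' : Y' ~> Z') (w' : Z' ~> shift X')
      (a : X ~> X') (b : Y ~> Y') (c : Z ~> Z'),
    is_iso a -> is_iso b -> is_iso c ->
    b \oc u = u' \oc a -> c \oc v = v' \oc b -> fmap shift a \oc w = w' \oc c ->
    dist u v w -> dist u' v' w';
  dist_id : forall X Z : tri_cat, is_zero Z ->
    dist (idm X) (0 : X ~> Z) (0 : Z ~> shift X);
  dist_cone : forall (X Y : tri_cat) (u : X ~> Y),
    exists (Z : tri_cat) (v : Y ~> Z) (w : Z ~> shift X), dist u v w;
  (* TR2 *)
  dist_rot : forall (X Y Z : tri_cat)
      (u : X ~> Y) (v : Y ~> Z) (w : Z ~> shift X),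
    dist u v w <-> dist v w (- fmap shift u);
  (* TR3 *)
  dist_morph : forall (X Y Z X' Y' Z' : tri_cat)
      (u : X ~> Y) (v : Y ~> Z) (w : Z ~> shift X)
      (u' : X' ~> Y') (v' : Y' ~> Z') (w' : Z' ~> shift X')
      (a : X ~> X') (b : Y ~> Y'),
    dist u v w -> dist u' v' w' -> b \oc u = u' \oc a ->
    exists c : Z ~> Z', c \oc v = v' \oc b /\ fmap shift a \oc w = w' \oc c;
  (* TR4, the octahedral axiom *)
  dist_octa : forall (X Y Z X' Y' Z' : tri_cat) (f : X ~> Y) (g : Y ~> Z)
      (f1 : Y ~> Z') (f2 : Z' ~> shift X)
      (g1 : Z ~> X') (g2 : X' ~> shift Y)
      (h1 : Z ~> Y') (h2 : Y' ~> shift X),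
    dist f f1 f2 -> dist g g1 g2 -> dist (g \oc f) h1 h2 ->
    exists (i : Z' ~> Y') (j : Y' ~> X'),
      [/\ dist i j (fmap shift f1 \oc g2),
          i \oc f1 = h1 \oc g, h2 \oc i = f2,
          j \oc h1 = g1 & g2 \oc j = fmap shift f \oc h2]
}.

Arguments shift {_}.
Arguments unshift {_}.
Arguments shift_unit {_} _.
Arguments shift_counit {_} _.
Arguments dist {_ _ _ _} _ _ _.

(* "Thick" does not include stability under shifts or cones. *)
Record thickSubcat (C : preadditiveCat) := ThickSubcat {
  thick_set :> C -> Prop;
  thick_zero : forall Z : C, is_zero Z -> thick_set Z;
  thick_iso : forall (A B : C) (f : A ~> B), is_iso f ->
    thick_set A -> thick_set B;
  thick_sum : forall A B P : C, is_biproduct A B P ->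
    thick_set A -> thick_set B -> thick_set P;
  thick_summand : forall A B P : C, is_biproduct A B P ->
    thick_set P -> thick_set A
}.

Program Definition thickI (C : preadditiveCat) (U V : thickSubcat C) :
    thickSubcat C :=
  @ThickSubcat C [set A | U A /\ V A] _ _ _ _.
Next Obligation. by move=> C U V Z Z0; split; apply: thick_zero. Qed.
Next Obligation.
by move=> C U V A B f fI [UA VA]; split; apply: (thick_iso fI).
Qed.
Next Obligation.
by move=> C U V A B P bP [UA VA] [UB VB]; split; apply: (thick_sum bP).
Qed.
Next Obligation.
by move=> C U V A B P bP [UP VP]; split; apply: (thick_summand bP).
Qed.

Section CompTheory.
Variable C : preadditiveCat.
Implicit Types A B D : C.

Lemma comp0m A B D (f : A ~> B) : (0 : B ~> D) \oc f = 0.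
Proof. by apply: (addrI (0 \oc f)); rewrite -compmDl !addr0. Qed.

Lemma compm0 A B D (g : B ~> D) : g \oc (0 : A ~> B) = 0.
Proof. by apply: (addrI (g \oc 0)); rewrite -compmDr !addr0. Qed.

Lemma compNm A B D (g : B ~> D) (f : A ~> B) : (- g) \oc f = - (g \oc f).
Proof. by apply: (addrI (g \oc f)); rewrite -compmDl !subrr comp0m. Qed.

Lemma compmN A B D (g : B ~> D) (f : A ~> B) : g \oc (- f) = - (g \oc f).
Proof. by apply: (addrI (g \oc f)); rewrite -compmDr !subrr compm0. Qed.

Lemma compmBl A B D (g1 g2 : B ~> D) (f : A ~> B) :
  (g1 - g2) \oc f = g1 \oc f - g2 \oc f.
Proof. by rewrite compmDl compNm. Qed.

Lemma compmBr A B D (g : B ~> D) (f1 f2 : A ~> B) :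
  g \oc (f1 - f2) = g \oc f1 - g \oc f2.
Proof. by rewrite compmDr compmN. Qed.

End CompTheory.

Section QuotientCategory.
Variables (C : preadditiveCat) (addC : is_additive C) (W : thickSubcat C).
Implicit Types A B D : C.

Definition factors A B (f : A ~> B) : Prop :=
  exists2 X : C, W X & exists (g : A ~> X) (h : X ~> B), f = h \oc g.

Definition factorsb A B (f : A ~> B) : bool := `[< factors f >].

Lemma factorsb_zmod_closed A B : zmod_closed (@factorsb A B).
Proof.
split=> [|f1 f2].
  have [Z Z0] := additive_zero addC.
  apply/asboolP; exists Z; first exact: thick_zero.
  by exists 0, 0; rewrite comp0m.
move=> /asboolP[X1 W1 [g1 [h1 ->]]] /asboolP[X2 W2 [g2 [h2 ->]]].
have [P bP] := additive_biproduct addC X1 X2.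
apply/asboolP; exists P; first exact: thick_sum bP W1 W2.
have [i1 [i2 [p1 [p2 [e11 e22 e12 e21 _]]]]] := bP.
exists (i1 \oc g1 + i2 \oc g2), (h1 \oc p1 - h2 \oc p2).
rewrite compmBl !compmDr -!compmA (compmA p1 i1) (compmA p1 i2).
by rewrite (compmA p2 i1) (compmA p2 i2) e11 e22 e12 e21 !comp0m !comp1m
  !compm0 addr0 add0r.
Qed.

Definition factors_ideal A B : zmodClosed (A ~> B) :=
  HB.pack (@factorsb A B)
    (GRing.isZmodClosed.Build (A ~> B) (@factorsb A B)
       (@factorsb_zmod_closed A B)).

Local Open Scope quotient_scope.

Definition quot_hom A B : zmodType :=
  Quotient.quot (factors_ideal A B).

Definition quot_proj A B (f : A ~> B) : quot_hom A B := \pi_(quot_hom A B) f.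

Definition quot_comp A B D (g : quot_hom B D) (f : quot_hom A B) :
    quot_hom A D :=
  quot_proj (repr g \oc repr f).

Lemma quot_projP A B (f g : A ~> B) :
  quot_proj f = quot_proj g <-> factors (f - g).
Proof.
rewrite (rwP (asboolP (factors _))) -/(factorsb (f - g)).
rewrite -[factorsb _]/(f - g \in factors_ideal A B).
by rewrite Quotient.idealrBE; split=> /eqP.
Qed.

Lemma quot_projK A B (x : quot_hom A B) : quot_proj (repr x) = x.
Proof. exact: reprK. Qed.

Lemma quot_projD A B (f g : A ~> B) :
  quot_proj (f + g) = quot_proj f + quot_proj g.
Proof. exact: raddfD. Qed.

Lemma quot_proj_comp A B D (g : B ~> D) (f : A ~> B) :
  quot_proj (g \oc f) = quot_comp (quot_proj g) (quot_proj f).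
Proof.
rewrite /quot_comp; set g' := repr _; set f' := repr _.
have /quot_projP[X WX [a [b eg]]] : quot_proj g = quot_proj g'.
  by rewrite quot_projK.
have /quot_projP[Y WY [c [d ef]]] : quot_proj f = quot_proj f'.
  by rewrite quot_projK.
transitivity (quot_proj (g' \oc f)); apply/quot_projP.
  rewrite -compmBl eg; exists X => //.
  by exists (a \oc f), b; rewrite compmA.
rewrite -compmBr ef; exists Y => //.
by exists c, (g' \oc d); rewrite compmA.
Qed.

Program Definition quotCat : preadditiveCat :=
  @PreadditiveCat C quot_hom (fun A => quot_proj (idm A)) quot_comp _ _ _ _ _.
Next Obligation.
by move=> A B f; rewrite -(quot_projK f) -quot_proj_comp comp1m.
Qed.
Next Obligation.
by move=> A B f; rewrite -(quot_projK f) -quot_proj_comp compm1.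
Qed.
Next Obligation.
move=> A B D E h g f; rewrite -(quot_projK f) -(quot_projK g) -(quot_projK h).
by rewrite -!quot_proj_comp compmA.
Qed.
Next Obligation.
move=> A B D g1 g2 f.
rewrite -(quot_projK f) -(quot_projK g1) -(quot_projK g2).
by rewrite -quot_projD -!quot_proj_comp compmDl quot_projD.
Qed.
Next Obligation.
move=> A B D g f1 f2.
rewrite -(quot_projK g) -(quot_projK f1) -(quot_projK f2).
by rewrite -quot_projD -!quot_proj_comp compmDr quot_projD.
Qed.

End QuotientCategory.

Definition fullSubcat (C : preadditiveCat) (S : set C) : preadditiveCat :=
  @PreadditiveCat {A : C | S A}
    (fun A B => sval A ~> sval B)
    (fun A => idm (sval A))
    (fun _ _ _ g f => g \oc f)
    (fun _ _ => @comp1m C _ _) (fun _ _ => @compm1 C _ _)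
    (fun _ _ _ _ => @compmA C _ _ _ _)
    (fun _ _ _ => @compmDl C _ _ _) (fun _ _ _ => @compmDr C _ _ _).

Section CotorsionPair.
Variables (C : triangulatedCat) (U V : thickSubcat C).

Record cotorsion_pair : Prop := CotorsionPair {
  cotorsion_ext : forall A B : C, U A -> V B ->
    forall f : A ~> shift B, f = 0;
  cotorsion_dist : forall X : C, exists (A B : C) (f : A ~> X)
      (g : X ~> shift B) (h : shift B ~> shift A),
    [/\ U A, V B & dist f g h]
}.

Let W := thickI U V.

Definition Cplus : set C := [set X | exists (W0 V0 : C) (f : W0 ~> X)
    (g : X ~> shift V0) (h : shift V0 ~> shift W0),
  [/\ W W0, V V0 & dist f g h]].

(* The third morphism h : W0 -> U0 of a triangle starting at U0[-1] is composed
   with the isomorphism U0 -> U0[-1][1]. *)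
Definition Cminus : set C := [set X | exists (U0 W0 : C) (f : unshift U0 ~> X)
    (g : X ~> W0) (h : W0 ~> U0),
  [/\ U U0, W W0 & dist f g (shift_counit U0 \oc h)]].

Definition heart : preadditiveCat :=
  @fullSubcat (quotCat (tri_additive C) W) (Cplus `&` Cminus).

End CotorsionPair.

(* Main.v *)
From mathcomp Require Import all_boot all_algebra.
From mathcomp Require Import boolp classical_sets.
Require Import Defs.

Set Implicit Arguments.
Unset Strict Implicit.
Unset Printing Implicit Defensive.

Import GRing.Theory.

Local Open Scope ring_scope.
Local Open Scope cat_scope.

(** Why the heart is abelian.  Write E(D, A) for the group of morphisms
D -> A[1]; it is covariant in A by [push] and contravariant in D by [pull].
Everything below uses only this bifunctor and the triangles A -> B -> D with
their class in E(D, A).  In this language the two sides of the theory are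
mirror images: passing to the opposite category exchanges A and D, push and
pull, U and V.  Hence only cokernels and epimorphisms are treated by hand
([coker_mod_exists], [epi_normal]); kernels and monomorphisms follow by duality
([ker_mod_exists], [mono_normal]).

The subcategories C^+ and C^- are used through an orthogonality property.  An
object X is in C^+ exactly when every class in E(U2, U1), with U1 and U2 in U,
dies along every morphism U1 -> X ([posi], [CplusP]); C^- is the mirror image
([nega], [CminusP]).  This makes closure under biproducts immediate and turns
membership checks into diagram chases.

Cokernels.  Let f : A -> B with A in C^-, and take a triangle A -> W_A -> U_A of
class a with W_A in W and U_A in U.  Realise f_* a by B -> M -> U_A.  A morphism
g out of B extends to M as soon as g f factors through W, because then
g_* f_* a = 0; uniqueness modulo W holds for targets in C^+ ([conf_epi]).  The
object M is in C^- but perhaps not in C^+.  To repair this, take a U-cover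
U0 -> M, a triangle U0 -> V1 -> U1, push its class forward to M and realise it by
M -> Z -> U1: this makes Z an object of C^+ through which all morphisms from M
to C^+ factor ([reflection]).  Then B -> M -> Z is the cokernel.

Normality.  If f is epi modulo W, the cokernel vanishes, and this forces M to
be in U ([epi_weak_coker]).  Let K -> N -> A be the kernel, built by the mirror
construction.  The class of M -> U_A pulled back from a, an element of E(M, A),
dies in B, so it lifts to N, and then to K because the obstruction lies in
E(M, V0) = 0 for some V0 in V.  A morphism g : A -> T that kills K modulo W
therefore kills this class, since E(M, W) = 0, and hence factors through f
modulo W.  So f is the cokernel of its kernel. *)

(** * Additive categories with extensions, and their opposites *)

(** A self-dual list of the consequences of the axioms of a triangulated
category that the argument needs: [conf u v e] reads
A -u-> B -v-> D is a triangle with class e in E(D, A).  Beyond the six-term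
exactness properties and the morphisms of triangles, [conf_push_extend] and
[conf_pull_lift] stand for the vanishing of an obstruction in a second
extension group: if x dies along a, its product with a_* e is zero. *)
Record extCat := ExtCat {
  ext_cat :> preadditiveCat;
  ext : ext_cat -> ext_cat -> zmodType;
  push : forall D A A' : ext_cat, (A ~> A') -> ext D A -> ext D A';
  pull : forall D D' A : ext_cat, (D' ~> D) -> ext D A -> ext D' A;
  push0 : forall (D A A' : ext_cat) (a : A ~> A'), push a (0 : ext D A) = 0;
  pull0 : forall (D D' A : ext_cat) (c : D' ~> D), pull c (0 : ext D A) = 0;
  pushM : forall (D A A' A'' : ext_cat) (a' : A' ~> A'') (a : A ~> A')
    (e : ext D A), push (a' \oc a) e = push a' (push a e);
  pullM : forall (D D' D'' A : ext_cat) (c : D' ~> D) (c' : D'' ~> D')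
    (e : ext D A), pull (c \oc c') e = pull c' (pull c e);
  push_pull : forall (D D' A A' : ext_cat) (a : A ~> A') (c : D' ~> D)
    (e : ext D A), push a (pull c e) = pull c (push a e);
  pushD : forall (D A A' : ext_cat) (a b : A ~> A') (e : ext D A),
    push (a + b) e = push a e + push b e;
  pullD : forall (D D' A : ext_cat) (c d : D' ~> D) (e : ext D A),
    pull (c + d) e = pull c e + pull d e;
  conf : forall A B D : ext_cat, (A ~> B) -> (B ~> D) -> ext D A -> Prop;
  conf_realize : forall (A D : ext_cat) (e : ext D A),
    exists (B : ext_cat) (u : A ~> B) (v : B ~> D), conf u v e;
  conf_push0 : forall (A B D : ext_cat) (u : A ~> B) (v : B ~> D) (e : ext D A),
    conf u v e -> push u e = 0;
  conf_pull0 : forall (A B D : ext_cat) (u : A ~> B) (v : B ~> D) (e : ext D A),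
    conf u v e -> pull v e = 0;
  conf_coker : forall (A B D : ext_cat) (u : A ~> B) (v : B ~> D) (e : ext D A)
    (T : ext_cat) (g : B ~> T),
    conf u v e -> g \oc u = 0 -> exists h, g = h \oc v;
  conf_ker : forall (A B D : ext_cat) (u : A ~> B) (v : B ~> D) (e : ext D A)
    (T : ext_cat) (x : T ~> B),
    conf u v e -> v \oc x = 0 -> exists y, x = u \oc y;
  conf_extend : forall (A B D : ext_cat) (u : A ~> B) (v : B ~> D)
    (e : ext D A) (T : ext_cat) (g : A ~> T),
    conf u v e -> push g e = 0 -> exists h, g = h \oc u;
  conf_lift : forall (A B D : ext_cat) (u : A ~> B) (v : B ~> D) (e : ext D A)
    (T : ext_cat) (x : T ~> D),
    conf u v e -> pull x e = 0 -> exists y, x = v \oc y;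
  conf_ext_coker : forall (A B D : ext_cat) (u : A ~> B) (v : B ~> D)
    (e : ext D A) (T : ext_cat) (x : ext B T),
    conf u v e -> pull u x = 0 -> exists y, x = pull v y;
  conf_ext_ker : forall (A B D : ext_cat) (u : A ~> B) (v : B ~> D)
    (e : ext D A) (T : ext_cat) (x : ext T B),
    conf u v e -> push v x = 0 -> exists y, x = push u y;
  conf_conn_push : forall (A B D : ext_cat) (u : A ~> B) (v : B ~> D)
    (e : ext D A) (T : ext_cat) (x : ext D T),
    conf u v e -> pull v x = 0 -> exists h, x = push h e;
  conf_conn_pull : forall (A B D : ext_cat) (u : A ~> B) (v : B ~> D)
    (e : ext D A) (T : ext_cat) (x : ext T A),
    conf u v e -> push u x = 0 -> exists y, x = pull y e;
  conf_morph_push : forall (A B D A' B' : ext_cat) (u : A ~> B) (v : B ~> D)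
    (e : ext D A) (a : A ~> A') (u' : A' ~> B') (v' : B' ~> D),
    conf u v e -> conf u' v' (push a e) ->
    exists b : B ~> B', b \oc u = u' \oc a /\ v' \oc b = v;
  conf_morph_pull : forall (A B D B' D' : ext_cat) (u : A ~> B) (v : B ~> D)
    (e : ext D A) (c : D' ~> D) (u' : A ~> B') (v' : B' ~> D'),
    conf u v e -> conf u' v' (pull c e) ->
    exists b : B' ~> B, v \oc b = c \oc v' /\ b \oc u' = u;
  conf_push_extend : forall (A A' B' D : ext_cat) (a : A ~> A') (e : ext D A)
    (u' : A' ~> B') (v' : B' ~> D) (T : ext_cat) (x : ext A' T),
    conf u' v' (push a e) -> pull a x = 0 -> exists y, x = pull u' y;
  conf_pull_lift : forall (A B' D D' : ext_cat) (c : D' ~> D) (e : ext D A)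
    (u' : A ~> B') (v' : B' ~> D') (T : ext_cat) (x : ext T D'),
    conf u' v' (pull c e) -> push c x = 0 -> exists y, x = push v' y
}.

Arguments ext {_} _ _.
Arguments push {_ _ _ _} _ _.
Arguments pull {_ _ _ _} _ _.
Arguments conf {_ _ _ _} _ _ _.

Definition opCat (C : preadditiveCat) : preadditiveCat :=
  @PreadditiveCat C (fun A B => @hom C B A) (@idm C)
    (fun A B D g f => @compm C D B A f g)
    (fun A B f => @compm1 C B A f) (fun A B f => @comp1m C B A f)
    (fun A B D E h g f => esym (@compmA C E D B A f g h))
    (fun A B D g1 g2 f => @compmDr C D B A f g1 g2)
    (fun A B D g f1 f2 => @compmDl C D B A f1 f2 g).

(** Each axiom of the opposite structure is the mirror axiom of the original
one, which is how the list in [extCat] has been chosen. *)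
Definition opExt (S : extCat) : extCat.
Proof.
refine (@ExtCat (opCat S) (fun D A => @ext S A D)
  (fun D A A' a e => @pull S A A' D a e)
  (fun D D' A c e => @push S A D D' c e)
  (fun D A A' => @pull0 S A A' D) (fun D D' A => @push0 S A D D')
  (fun D A A' A'' a' a => @pullM S A A' A'' D a a')
  (fun D D' D'' A c c' => @pushM S A D D' D'' c' c)
  (fun D D' A A' a c e => esym (@push_pull S A A' D D' c a e))
  (fun D A A' => @pullD S A A' D) (fun D D' A => @pushD S A D D')
  (fun A B D u v e => @conf S D B A v u e)
  _
  (fun A B D u v => @conf_pull0 S D B A v u)
  (fun A B D u v => @conf_push0 S D B A v u)
  (fun A B D u v => @conf_ker S D B A v u)
  (fun A B D u v => @conf_coker S D B A v u)
  (fun A B D u v => @conf_lift S D B A v u)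
  (fun A B D u v => @conf_extend S D B A v u)
  (fun A B D u v => @conf_ext_ker S D B A v u)
  (fun A B D u v => @conf_ext_coker S D B A v u)
  (fun A B D u v => @conf_conn_pull S D B A v u)
  (fun A B D u v => @conf_conn_push S D B A v u)
  _ _
  (fun A A' B' D a e u' v' => @conf_pull_lift S D B' A A' a e v' u')
  (fun A B' D D' c e u' v' => @conf_push_extend S D D' B' A c e v' u')).
- move=> A D e; have [B [u [v uv]]] := conf_realize e.
  by exists B, v, u.
- move=> A B D A' B' u v e a u' v' c1 c2.
  exact: (@conf_morph_pull S D B A B' A' v u e a v' u' c1 c2).
- move=> A B D B' D' u v e c u' v' c1 c2.
  exact: (@conf_morph_push S D B A D' B' v u e c v' u' c1 c2).
Defined.

(** * Cotorsion pairs and the two halves of the heart *)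

Definition fact (C : preadditiveCat) (P : C -> Prop) (A B : C) (f : A ~> B) :=
  exists2 X : C, P X & exists (g : A ~> X) (h : X ~> B), f = h \oc g.

Lemma fact_op (C : preadditiveCat) (P Q : C -> Prop) (A B : C) (f : A ~> B) :
  @fact (opCat C) (fun X => Q X /\ P X) B A f <->
  fact (fun X => P X /\ Q X) f.
Proof. by split=> -[X [? ?] [g [h ->]]]; exists X => //; exists h, g. Qed.

Lemma fact_compl (C : preadditiveCat) (P : C -> Prop) (A B D : C)
  (g : B ~> D) (f : A ~> B) : fact P f -> fact P (g \oc f).
Proof.
by case=> X PX [a [b ->]]; exists X => //; exists a, (g \oc b); rewrite compmA.
Qed.

Lemma fact_compr (C : preadditiveCat) (P : C -> Prop) (A B D : C)
  (g : B ~> D) (f : A ~> B) : fact P g -> fact P (g \oc f).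
Proof.
by case=> X PX [a [b ->]]; exists X => //; exists (a \oc f), b; rewrite compmA.
Qed.

(** For thick subcategories the perpendicularity conditions follow from the
existence of covers and hulls; taking them as part of the notion avoids direct
summands and makes it self-dual.  [cot_sub] is what closure of U and V under
sums gives for morphisms: those that factor through the intersection form
subgroups. *)
Record cotorsion (S : extCat) (U V : S -> Prop) : Prop := Cotorsion {
  cot_ext : forall A B : S, U A -> V B -> forall e : ext A B, e = 0;
  cot_perpl : forall A : S,
    (forall B : S, V B -> forall e : ext A B, e = 0) -> U A;
  cot_perpr : forall B : S,
    (forall A : S, U A -> forall e : ext A B, e = 0) -> V B;
  cot_cover : forall X : S, exists (B A : S) (u : B ~> A) (v : A ~> X)
    (e : ext X B), [/\ V B, U A & conf u v e];
  cot_hull : forall X : S, exists (B A : S) (u : X ~> B) (v : B ~> A)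
    (e : ext A X), [/\ V B, U A & conf u v e];
  cot_sub : forall (A B : S) (f g : A ~> B),
    fact (fun X => U X /\ V X) f -> fact (fun X => U X /\ V X) g ->
    fact (fun X => U X /\ V X) (f - g)
}.

Lemma cotorsion_op (S : extCat) (U V : S -> Prop) :
  cotorsion U V -> @cotorsion (opExt S) V U.
Proof.
case=> ce cl cr cc ch cs; split.
- by move=> A B VA UB e; exact: ce.
- by move=> A h; apply: cr.
- by move=> A h; apply: cl.
- by move=> X; have [B [A [u [v [e [VB UA c]]]]]] := ch X; exists A, B, v, u, e.
- by move=> X; have [B [A [u [v [e [VB UA c]]]]]] := cc X; exists A, B, v, u, e.
- by move=> A B f g /(@fact_op S) Wf /(@fact_op S) Wg; apply/(@fact_op S)/cs.
Qed.

(** C^+ in orthogonal form.  If X admits a triangle W0 -> X -> V0[1], a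
morphism from U to X factors through W0, and E(U, W0) = 0; conversely the
condition says exactly that the U-cover of X lies in V. *)
Definition posi (S : extCat) (U : S -> Prop) (X : S) : Prop :=
  forall A B : S, U A -> U B -> forall (f : A ~> X) (e : ext B A), push f e = 0.

Definition nega (S : extCat) (V : S -> Prop) (X : S) : Prop :=
  @posi (opExt S) V X.

Lemma negaE (S : extCat) (V : S -> Prop) (X : S) : nega V X ->
  forall A B : S, V A -> V B -> forall (g : X ~> A) (e : ext A B), pull g e = 0.
Proof. by []. Qed.

Definition in_heart (S : extCat) (U V : S -> Prop) (X : S) : Prop :=
  posi U X /\ nega V X.

(** * Cokernels in the heart *)

Section Cokernels.
Variables (S : extCat) (U V : S -> Prop) (cUV : cotorsion U V).

Let W X := U X /\ V X.

Lemma fact_add (A B : S) (f g : A ~> B) : fact W f -> fact W g ->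
  fact W (f + g).
Proof.
move=> Wf Wg; rewrite -[g]opprK; apply: (cot_sub cUV) => //.
by rewrite -[g]comp1m -compNm; apply: fact_compl.
Qed.

(** The groups E(U, W) and E(W, V) vanish: this and its mirror image
[pull_fact] are what morphisms factoring through W are good for. *)
Lemma push_fact (A X Y : S) (f : X ~> Y) (e : ext A X) : U A -> fact W f ->
  push f e = 0.
Proof.
move=> UA [T [_ VT] [a [b ->]]].
by rewrite pushM (cot_ext cUV UA VT (push a e)) push0.
Qed.

Lemma pull_fact (B X Y : S) (f : X ~> Y) (e : ext Y B) : V B -> fact W f ->
  pull f e = 0.
Proof.
move=> VB [T [UT _] [a [b ->]]].
by rewrite pullM (cot_ext cUV UT VB (pull b e)) pull0.
Qed.

(** For V -> U -> X with X in C^+, every class in E(U', U) dies in E(U', X) and so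
comes from E(U', V) = 0; by perpendicularity U is in V as well. *)
Lemma posi_cover (X : S) : posi U X ->
  exists (B A : S) (u : B ~> A) (v : A ~> X) (e : ext X B),
    [/\ V B, W A & conf u v e].
Proof.
move=> pX; have [B [A [u [v [e [VB UA c]]]]]] := cot_cover cUV X.
exists B, A, u, v, e; split=> //; split=> //.
apply: (cot_perpr cUV) => D UD x.
have [y ->] := conf_ext_ker c (pX _ _ UA UD v x).
by rewrite (cot_ext cUV UD VB y) push0.
Qed.

(** A morphism from U to X lifts to the cover of X, which is in W. *)
Lemma posi_fact (A X : S) (f : A ~> X) : U A -> posi U X -> fact W f.
Proof.
move=> UA /posi_cover[B [T [u [v [e [VB WT c]]]]]].
have [y ->] := conf_lift c (cot_ext cUV UA VB (pull f e)).
by exists T => //; exists y, v.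
Qed.

Lemma posi_biproduct (X Y P : S) : is_biproduct X Y P ->
  posi U X -> posi U Y -> posi U P.
Proof.
move=> [i1 [i2 [p1 [p2 [_ _ _ _ sumP]]]]] pX pY A B UA UB f e.
rewrite -[f]comp1m -sumP compmDl pushD -!compmA pushM (pushM i2).
by rewrite (pX _ _ UA UB) (pY _ _ UA UB) !push0 addr0.
Qed.

Lemma posi_zero (Z : S) : is_zero Z -> posi U Z.
Proof.
move=> Z0 A B _ _ f e; rewrite ((Z0 A).1 f).
by apply: (addrI (push (0 : A ~> Z) e)); rewrite -pushD !addr0.
Qed.

(** Enlarging an object by an object of U on the right stays inside C^-: a
class that dies on X comes from E(U, V) = 0. *)
Lemma nega_conf (X Z D : S) (u : X ~> Z) (v : Z ~> D) (e : ext D X) :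
  conf u v e -> U D -> nega V X -> nega V Z.
Proof.
move=> c UD nX A B VA VB g x.
change (@pull S A Z B g x = 0).
have [|y ->] := @conf_ext_coker _ _ _ _ _ _ _ _ (@pull S A Z B g x) c.
  by rewrite -pullM; apply: (negaE nX).
by rewrite (cot_ext cUV UD VB y) pull0.
Qed.

(** Uniqueness in all the universal properties.  If h u = b a through T in W,
then a extends to Z because E(D, T) = 0; after correcting h by this extension
it kills u and so comes from D, which is in U, where [posi_fact] applies. *)
Lemma conf_epi (X Z D Y : S) (u : X ~> Z) (v : Z ~> D) (e : ext D X)
  (h : Z ~> Y) : conf u v e -> U D -> posi U Y ->
  fact W (h \oc u) -> fact W h.
Proof.
move=> c UD pY [T [UT VT] [a [b hu]]].
have [a' ea] := conf_extend c (cot_ext cUV UD VT (push a e)).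
have [|y ey] := @conf_coker _ _ _ _ _ _ _ _ (h - b \oc a') c.
  by rewrite compmBl hu -compmA -ea subrr.
rewrite -[h](subrK (b \oc a')) ey; apply: fact_add.
  exact/fact_compr/posi_fact.
by exists T => //; exists a', b.
Qed.

(** The cokernel of f with respect to targets in C^+, before reflection: push
the hull triangle of A forward along f.  The hull of an object of C^- is in W,
by the mirror image of [posi_cover]. *)
Lemma weak_coker (A B : S) (f : A ~> B) : nega V A ->
  exists (T D : S) (i : A ~> T) (j : T ~> D) (a : ext D A)
    (M : S) (m : B ~> M) (v : M ~> D),
    [/\ W T, U D, conf i j a & conf m v (push f a)].
Proof.
move=> nA; have [T [D [i [j [a [VT UD c]]]]]] := cot_hull cUV A.
have [M [m [v cm]]] := conf_realize (push f a).
exists T, D, i, j, a, M, m, v; split=> //; split=> //.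
apply: (cot_perpl cUV) => E VE x.
have [y ->] := conf_ext_coker c (negaE nA VT VE i x).
by rewrite (cot_ext cUV UD VE y) pull0.
Qed.

(** The reflection of X into C^+ modulo W.  A morphism from X to an object of C^+
kills [push f e] whenever A and D are in U, so it extends to Z.  To get Z itself
into C^+ it is enough to do this once, with f the U-cover of X and e the class
of the hull of A. *)
Lemma reflection (X : S) : exists (A D : S) (f : A ~> X) (e : ext D A)
  (Z : S) (z : X ~> Z) (r : Z ~> D),
  [/\ U A, U D, conf z r (push f e) & posi U Z].
Proof.
have [B [A [s [f [d [VB UA cX]]]]]] := cot_cover cUV X.
have [T [D [j [p [e [VT UD cA]]]]]] := cot_hull cUV A.
have [Z [z [r cZ]]] := conf_realize (push f e).
have [q [qj rq]] := conf_morph_push cA cZ.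
exists A, D, f, e, Z, z, r; split=> // E F UE UF g x.
(* It is enough to factor morphisms from U to Z through T, which lies in V. *)
suff [w ->] : exists w : E ~> T, g = q \oc w.
  by rewrite pushM (cot_ext cUV UF VT (push w x)) push0.
have re0 : pull (r \oc g) e = 0.
  (* It dies in [ext E X], hence comes from [ext E B], which is zero. *)
  have [|y ->] := @conf_ext_ker _ _ _ _ _ _ _ _ (pull (r \oc g) e) cX.
    by rewrite push_pull pullM (conf_pull0 cZ) pull0.
  by rewrite (cot_ext cUV UE VB y) push0.
have [y ey] := conf_lift cA re0.
(* So g and q y agree on D, and their difference comes from X, even from the
   cover A since [ext E B] is zero; on A the map z f is q j. *)
have [|x0 ex0] := @conf_ker _ _ _ _ _ _ _ _ (g - q \oc y) cZ.
  by rewrite compmBr compmA rq -ey subrr.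
have [x1 ex1] := conf_lift cX (cot_ext cUV UE VB (pull x0 d)).
exists (y + j \oc x1).
by rewrite compmDr compmA qj -compmA -ex1 -ex0 addrC subrK.
Qed.

(** A cokernel in the quotient by W among the objects of the heart, in terms
of representatives. *)
Definition coker_mod (A B Z : S) (f : A ~> B) (k : B ~> Z) : Prop :=
  fact W (k \oc f) /\ forall T : S, in_heart U V T ->
    (forall g : B ~> T, fact W (g \oc f) -> exists h, fact W (h \oc k - g)) /\
    (forall h : Z ~> T, fact W (h \oc k) -> fact W h).

Lemma coker_mod_exists (A B : S) (f : A ~> B) :
  in_heart U V A -> in_heart U V B ->
  exists (Z : S) (k : B ~> Z), in_heart U V Z /\ coker_mod f k.
Proof.
move=> [_ nA] [_ nB].
have [T [D [i [j [a [M [m [v [WT UD ca cm]]]]]]]]] := weak_coker f nA.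
have [A0 [D0 [f0 [e0 [Z [z [r [UA0 UD0 cz pZ]]]]]]]] := reflection M.
exists Z, (z \oc m); split.
  by split=> //; apply: (nega_conf cz UD0); apply: (nega_conf cm UD).
split.
  rewrite -compmA; apply: fact_compl.
  have [|h ->] := @conf_extend _ _ _ _ _ _ _ _ (m \oc f) ca.
    by rewrite pushM (conf_push0 cm).
  by exists T => //; exists i, h.
move=> Y [pY nY]; split=> [g Wg | h].
  have [|h eh] := @conf_extend _ _ _ _ _ _ _ _ g cm.
    by rewrite -pushM; apply: push_fact.
  have [|h' eh'] := @conf_extend _ _ _ _ _ _ _ _ h cz.
    by rewrite -pushM; apply: pY.
  exists h'; rewrite compmA -eh' -eh subrr.
  by exists T => //; exists 0, 0; rewrite compm0.
rewrite compmA => /(conf_epi cm UD pY) Wh.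
exact: (conf_epi cz UD0 pY).
Qed.

(** If f is epi modulo W then its cokernel is zero, so the reflection M -> Z
factors through W.  A class x in E(M, V) extends to Z, since it is zero on the
U-cover of M along which the reflection is built; factoring through W then
forces x = 0. *)
Lemma epi_weak_coker (A B M D : S) (f : A ~> B) (a : ext D A)
    (m : B ~> M) (v : M ~> D) : in_heart U V B ->
  (forall (T : S), in_heart U V T ->
     forall h : B ~> T, fact W (h \oc f) -> fact W h) ->
  fact W (m \oc f) -> U D -> conf m v (push f a) -> U M.
Proof.
move=> [_ nB] epif Wmf UD cm.
have [A0 [D0 [f0 [e0 [Z [z [r [UA0 UD0 cz pZ]]]]]]]] := reflection M.
have Wz : fact W z.
  apply: (conf_epi cm UD pZ); apply: epif.
    by split=> //; apply: (nega_conf cz UD0); apply: (nega_conf cm UD).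
  by rewrite -compmA; apply: fact_compl.
apply: (cot_perpl cUV) => E VE x.
have [y ->] := conf_push_extend cz (cot_ext cUV UA0 VE (pull f0 x)).
exact: pull_fact.
Qed.

End Cokernels.

(** * Epimorphisms are cokernels *)

Section Normal.
Variables (S : extCat) (U V : S -> Prop) (cUV : cotorsion U V).

Let W X := U X /\ V X.

(** With M in U, the class pull v a in E(M, A) lifts to the kernel K; so a
morphism g that kills K modulo W satisfies pull v (push g a) = 0, which says
that push g a = push (h f) a for some h, that is, g - h f factors through the
hull of A. *)
Lemma epi_normal (A B : S) (f : A ~> B) :
  in_heart U V A -> in_heart U V B ->
  (forall (T : S), in_heart U V T ->
     forall h : B ~> T, fact W (h \oc f) -> fact W h) ->
  exists (K : S) (k : K ~> A), in_heart U V K /\ coker_mod U V k f.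
Proof.
move=> [pA nA] hB epif.
have cop := cotorsion_op cUV.
have [T [D [i [j [a [M [m [v [WT UD ca cm]]]]]]]]] := weak_coker cUV f nA.
have UM : U M.
  apply: (epi_weak_coker cUV hB epif _ UD cm).
  have [|h ->] := @conf_extend _ _ _ _ _ _ _ _ (m \oc f) ca.
    by rewrite pushM (conf_push0 cm).
  by exists T => //; exists i, h.
have [T' [B' [i' [j' [b [N [n [v' [WT' VB' cb cn]]]]]]]]] :=
  @weak_coker (opExt S) V U cop B A f hB.1.
have [B0 [D0 [c [e [K [k [r [VB0 VD0 ck nK]]]]]]]] :=
  @reflection (opExt S) V U cop N.
(* Read the objects and morphisms of the opposite category in S itself. *)
move: T' i' j' b N n v' WT' cb cn B0 c e k r ck nK VB0 => /=
  T' i' j' b N n v' WT' cb cn B0 c e k r ck nK VB0.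
exists K, (n \oc k); split.
  split=> //.
  apply: (@nega_conf (opExt S) V U cop _ _ _ _ _ _ ck VD0).
  exact: (@nega_conf (opExt S) V U cop _ _ _ _ _ _ cn VB').
split.
  rewrite compmA; apply: fact_compr.
  have [|h ->] := @conf_lift S _ _ _ _ _ _ _ (f \oc n) cb.
    by rewrite pullM; exact: (conf_pull0 cn).
  by exists T'; [case: WT' | exists h, i'].
move=> Y hY; split=> [g Wg|]; last exact: epif.
(* The class pull v a dies in B; lift it to N, then to K, the obstruction being
   in E(M, B0) = 0. *)
have fx0 : push f (pull v a) = 0 by rewrite push_pull (conf_pull0 cm).
have [y1 ey1] := @conf_pull_lift S _ _ _ _ _ _ _ _ _ _ cn fx0.
have [y2 ey2] := @conf_pull_lift S _ _ _ _ _ _ _ _ _ _ ck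
  (cot_ext cUV UM VB0 (push c y1)).
have gx0 : pull v (push g a) = 0.
  rewrite -push_pull ey1 ey2 -!pushM -compmA.
  exact: (push_fact cUV).
have [h eh] := conf_conn_push cm gx0.
exists h.
have [|t et] := @conf_extend _ _ _ _ _ _ _ _ (h \oc f - g) ca.
  apply: (addIr (push g a)).
  by rewrite -pushD subrK add0r eh pushM.
by rewrite et; exists T => //; exists i, t.
Qed.

End Normal.

(** * Kernels and monomorphisms, by duality *)

Section Dual.
Variables (S : extCat) (U V : S -> Prop) (cUV : cotorsion U V).

Let W X := U X /\ V X.

Lemma nega_biproduct (X Y P : S) : is_biproduct X Y P ->
  nega V X -> nega V Y -> nega V P.
Proof.
move=> [i1 [i2 [p1 [p2 [e11 e22 e12 e21 sumP]]]]].
apply: (@posi_biproduct (opExt S) V X Y P).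
by exists p1, p2, i1, i2; split.
Qed.

Lemma nega_zero (Z : S) : is_zero Z -> nega V Z.
Proof.
move=> Z0; apply: (@posi_zero (opExt S) V Z) => T.
by have [? ?] := Z0 T; split.
Qed.

Definition ker_mod (A B K : S) (f : A ~> B) (k : K ~> A) : Prop :=
  fact W (f \oc k) /\ forall T : S, in_heart U V T ->
    (forall g : T ~> A, fact W (f \oc g) -> exists h, fact W (k \oc h - g)) /\
    (forall h : T ~> K, fact W (k \oc h) -> fact W h).

Lemma coker_mod_op (A B K : S) (f : A ~> B) (k : K ~> A) :
  @coker_mod (opExt S) V U B A K f k -> ker_mod f k.
Proof.
move=> [/fact_op Wfk univ]; split=> // T [pT nT].
have [ex un] := univ T (conj nT pT); split=> [g Wg | h Wh].
  by have [|h /fact_op Wh] := ex g; [apply/(@fact_op S) | exists h].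
by apply/(@fact_op S)/un/(@fact_op S).
Qed.

Lemma ker_mod_exists (A B : S) (f : A ~> B) :
  in_heart U V A -> in_heart U V B ->
  exists (K : S) (k : K ~> A), in_heart U V K /\ ker_mod f k.
Proof.
move=> [pA nA] [pB nB].
have [K [k [[nK pK] kf]]] := @coker_mod_exists (opExt S) V U
  (cotorsion_op cUV) B A f (conj nB pB) (conj nA pA).
by exists K, k; split; [split | apply: coker_mod_op].
Qed.

Lemma mono_normal (A B : S) (f : A ~> B) :
  in_heart U V A -> in_heart U V B ->
  (forall (T : S), in_heart U V T ->
     forall h : T ~> A, fact W (f \oc h) -> fact W h) ->
  exists (D : S) (g : B ~> D), in_heart U V D /\ ker_mod g f.
Proof.
move=> [pA nA] [pB nB] monof.
have [|D [g [[nD pD] gf]]] := @epi_normal (opExt S) V U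
  (cotorsion_op cUV) B A f (conj nB pB) (conj nA pA).
  move=> T [nT pT] h /fact_op Wh.
  by apply/(@fact_op S)/monof.
by exists D, g; split; [split | apply: coker_mod_op].
Qed.

End Dual.

(** * Triangulated categories *)

Section Triangulated.
Variable C : triangulatedCat.
Implicit Types A B D T X Y Z : C.

Lemma fmap0 (P Q : preadditiveCat) (F : additiveFunctor P Q) (A B : P) :
  fmap F (0 : A ~> B) = 0.
Proof. by apply: (addrI (fmap F 0)); rewrite -fmapD !addr0. Qed.

Lemma fmapN (P Q : preadditiveCat) (F : additiveFunctor P Q) (A B : P)
  (f : A ~> B) : fmap F (- f) = - fmap F f.
Proof. by apply: (addrI (fmap F f)); rewrite -fmapD !subrr fmap0. Qed.

Lemma shift_faithful A B (f g : A ~> B) :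
  fmap shift f = fmap shift g -> f = g.
Proof.
move=> e; have [s [s1 _]] := shift_unit_iso B.
by rewrite -[f]comp1m -s1 -compmA -shift_unit_nat e shift_unit_nat compmA s1
  comp1m.
Qed.

Lemma unshift_faithful A B (f g : A ~> B) :
  fmap unshift f = fmap unshift g -> f = g.
Proof.
move=> e; have [s [s1 _]] := shift_counit_iso B.
by rewrite -[f]comp1m -s1 -compmA -shift_counit_nat e shift_counit_nat compmA
  s1 comp1m.
Qed.

Lemma shift_full A B (h : shift A ~> shift B) : exists f, h = fmap shift f.
Proof.
have [s [s1 s2]] := shift_unit_iso B; have [t [t1 t2]] := shift_unit_iso A.
exists (s \oc fmap unshift h \oc shift_unit A).
apply: unshift_faithful.
rewrite -[RHS]compm1 -t2 compmA shift_unit_nat !compmA s2 comp1m -compmA t2.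
by rewrite compm1.
Qed.

Lemma idm_iso A : is_iso (idm A).
Proof. by exists (idm A); rewrite comp1m. Qed.

Lemma zero_shift Z : is_zero Z -> is_zero (shift Z).
Proof.
move=> Z0; have id0 : idm (shift Z) = 0.
  by rewrite -fmap1 ((Z0 Z).1 (idm Z)) fmap0.
by move=> T; split=> f; [rewrite -[f]comp1m | rewrite -[f]compm1];
  rewrite id0 ?comp0m ?compm0.
Qed.

Lemma dist_rot1 A B D (u : A ~> B) (v : B ~> D) (w : D ~> shift A) :
  dist u v w -> dist v w (- fmap shift u).
Proof. exact: (dist_rot u v w).1. Qed.

Lemma dist_unrot A B D (u : A ~> B) (v : B ~> D) (w : D ~> shift A) :
  dist v w (- fmap shift u) -> dist u v w.
Proof. exact: (dist_rot u v w).2. Qed.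

Lemma dist_comp0 A B D (u : A ~> B) (v : B ~> D) (w : D ~> shift A) :
  dist u v w -> v \oc u = 0.
Proof.
move=> d; have [Z Z0] := additive_zero (tri_additive C).
have [|c [<- _]] := @dist_morph _ _ _ _ _ _ _ _ _ _ _ _ _ (idm A) u
  (dist_id A Z0) d; by rewrite ?compm0.
Qed.

(** The exactness of Hom(T, -): compare with the triangle T -> 0 -> T[1], and
use that the shift is full and faithful. *)
Lemma dist_ker A B D T (u : A ~> B) (v : B ~> D) (w : D ~> shift A)
  (x : T ~> B) : dist u v w -> v \oc x = 0 -> exists y, x = u \oc y.
Proof.
move=> d vx; have [Z Z0] := additive_zero (tri_additive C).
have [|c [_]] := @dist_morph _ _ _ _ _ _ _ _ _ _ _ _ _ x 0
  (dist_rot1 (dist_id T Z0)) (dist_rot1 d).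
  by rewrite comp0m vx.
have [y ->] := shift_full c.
rewrite fmap1 compmN compm1 compNm -fmapM => /oppr_inj/shift_faithful ->.
by exists y.
Qed.

(** The exactness of Hom(-, T): compare with the triangle 0 -> T = T. *)
Lemma dist_coker A B D T (u : A ~> B) (v : B ~> D) (w : D ~> shift A)
  (g : B ~> T) : dist u v w -> g \oc u = 0 -> exists h, g = h \oc v.
Proof.
move=> d gu; have [Z Z0] := additive_zero (tri_additive C).
have d0 : dist (0 : Z ~> T) (idm T) 0.
  apply: dist_unrot; rewrite fmap0 oppr0.
  exact: dist_id (zero_shift Z0).
have [|c [e _]] := @dist_morph _ _ _ _ _ _ _ _ _ _ _ _ _ 0 g d d0.
  by rewrite gu comp0m.
by exists c; rewrite e comp1m.
Qed.

(** Rotating twice moves the two given morphisms into first and second place,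
where the axiom on morphisms of triangles applies; the third morphism it gives
lies between shifts, hence is a shift. *)
Lemma dist_morph_mid A B D A' B' D' (u : A ~> B) (v : B ~> D)
  (w : D ~> shift A) (u' : A' ~> B') (v' : B' ~> D') (w' : D' ~> shift A')
  (a : A ~> A') (c : D ~> D') :
  dist u v w -> dist u' v' w' -> fmap shift a \oc w = w' \oc c ->
  exists b, b \oc u = u' \oc a /\ v' \oc b = c \oc v.
Proof.
move=> d d' e.
have [b [e1 e2]] := dist_morph (dist_rot1 (dist_rot1 d))
  (dist_rot1 (dist_rot1 d')) e.
have [b' eb] := shift_full b; move: e1 e2; rewrite {}eb.
rewrite !compmN !compNm -!fmapM => /oppr_inj/shift_faithful e1.
by move=> /oppr_inj/shift_faithful e2; exists b'.
Qed.

(** Complete e to a triangle D -> A[1] -> E and rotate it back, with E[-1] as the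
middle term. *)
Lemma dist_realize A D (e : D ~> shift A) :
  exists (B : C) (u : A ~> B) (v : B ~> D), dist u v e.
Proof.
have [E [v [w d]]] := dist_cone e.
have [s [s1 s2]] := shift_counit_iso E.
have [u' eu] := shift_full (shift_counit E \oc v).
have [v' ev] := shift_full (w \oc s).
exists (unshift E), (- u'), (- v').
do 2!apply: dist_unrot; rewrite !fmapN !opprK -eu -ev.
apply: (dist_iso (idm_iso _) (idm_iso _) (shift_counit_iso E)) d.
- by rewrite comp1m compm1.
- by rewrite compm1.
- by rewrite fmap1 comp1m -compmA s1 compm1.
Qed.

(** All exactness properties are those of Hom applied to rotations of the
triangle.  The last two hold because fmap shift x composed with
fmap shift a \oc e is zero when x \oc a = 0, and dually. *)
Definition tri_ext : extCat.
Proof.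
refine (@ExtCat C (fun D A => D ~> shift A)
  (fun D A A' a e => fmap shift a \oc e) (fun D D' A c e => e \oc c)
  _ _ _ _ _ _ _ (fun A B D u v e => dist u v e)
  dist_realize _ _ _ _ _ _ _ _ _ _ _ _ _ _).
- by move=> *; apply: compm0.
- by move=> *; apply: comp0m.
- by move=> *; rewrite fmapM compmA.
- by move=> *; rewrite compmA.
- by move=> *; rewrite compmA.
- by move=> *; rewrite fmapD compmDl.
- by move=> *; rewrite compmDr.
- move=> A B D u v e d; apply: oppr_inj; rewrite -compNm oppr0.
  exact: dist_comp0 (dist_rot1 (dist_rot1 d)).
- by move=> A B D u v e d; exact: dist_comp0 (dist_rot1 d).
- by move=> A B D u v e T g; exact: dist_coker.
- by move=> A B D u v e T g; exact: dist_ker.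
- move=> A B D u v e T g d /(dist_coker (dist_rot1 (dist_rot1 d)))[h].
  have [h' ->] := shift_full h.
  rewrite compmN -fmapM -fmapN => /shift_faithful ->.
  by exists (- h'); rewrite compNm.
- by move=> A B D u v e T x /dist_rot1; exact: dist_ker.
- by move=> A B D u v e T g; exact: dist_coker.
- move=> A B D u v e T x d vx.
  have [|y ->] := @dist_ker _ _ _ _ _ _ _ x
    (dist_rot1 (dist_rot1 (dist_rot1 d))).
    by rewrite compNm vx oppr0.
  by exists (- y); rewrite compNm compmN.
- move=> A B D u v e T x d /(dist_coker (dist_rot1 d))[h].
  by have [h' ->] := shift_full h; exists h'.
- move=> A B D u v e T x d ux.
  by apply: (dist_ker (dist_rot1 (dist_rot1 d))); rewrite compNm ux oppr0.
- move=> A B D A' B' u v e a u' v' d d'.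
  have [|b [e1 e2]] := @dist_morph_mid _ _ _ _ _ _ _ _ _ _ _ _ a (idm D) d d'.
    by rewrite compm1.
  by exists b; rewrite e1 e2 comp1m.
- move=> A B D B' D' u v e c u' v' d d'.
  have [|b [e1 e2]] := @dist_morph_mid _ _ _ _ _ _ _ _ _ _ _ _ (idm A) c d' d.
    by rewrite fmap1 comp1m.
  by exists b; rewrite e1 e2 compm1.
- move=> A A' B' D a e u' v' T x d xa.
  have [|h] := @dist_coker _ _ _ _ _ _ _ (fmap shift x)
    (dist_rot1 (dist_rot1 d)).
    by rewrite compmA -fmapM xa fmap0 comp0m.
  have [h' ->] := shift_full h.
  rewrite compmN -fmapM -fmapN => /shift_faithful ->.
  by exists (- h'); rewrite compNm.
- move=> A B' D D' c e u' v' T x d cx.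
  have [|y ->] := @dist_ker _ _ _ _ _ _ _ x
    (dist_rot1 (dist_rot1 (dist_rot1 (dist_rot1 d)))).
    by rewrite compNm fmapM -compmA cx compm0 oppr0.
  by exists (- y); rewrite compNm compmN.
Defined.

(** A triangle with zero class splits: it has a retraction r of u and a section t
of v, and t is corrected to t - u r t so that r kills it. *)
Lemma split_biproduct A B D (u : A ~> B) (v : B ~> D) :
  dist u v 0 -> is_biproduct A D B.
Proof.
move=> d; have d' : @conf tri_ext _ _ _ u v 0 := d.
have [|r er] := @conf_extend tri_ext _ _ _ _ _ _ _ (idm A) d'.
  by apply: compm0.
have [|t et] := @conf_lift tri_ext _ _ _ _ _ _ _ (idm D) d'.
  by apply: comp0m.
have vu := dist_comp0 d.
pose t' := t - u \oc r \oc t.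
have rt' : r \oc t' = 0.
  by rewrite /t' compmBr !compmA -er comp1m subrr.
have vt' : v \oc t' = idm D.
  by rewrite /t' compmBr !compmA vu !comp0m subr0 -et.
exists u, t', r, v; split=> //.
have [|x ex] := @dist_ker _ _ _ _ _ _ _ (idm B - t' \oc v) d.
  by rewrite compmBr compmA vt' compm1 comp1m subrr.
suff <- : x = r by rewrite -ex subrK.
by rewrite -[x]comp1m er -compmA -ex compmBr compmA rt' comp0m compm1 subr0.
Qed.

Lemma biproduct_sym A B P : is_biproduct A B P -> is_biproduct B A P.
Proof.
move=> [i1 [i2 [p1 [p2 [? ? ? ? e]]]]]; exists i2, i1, p2, p1.
by split=> //; rewrite addrC.
Qed.

Section Pair.
Variables (U V : thickSubcat C) (cUV : cotorsion_pair U V).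

Let W := thickI U V.

Lemma tri_cover X : exists (B A : C) (u : B ~> A) (v : A ~> X)
  (e : X ~> shift B), [/\ V B, U A & dist u v e].
Proof.
have [A [B [f [g [h [UA VB d]]]]]] := cotorsion_dist cUV X.
have [u eu] := shift_full h.
exists B, A, (- u), f, g; split=> //.
by apply: dist_unrot; rewrite fmapN opprK -eu.
Qed.

Lemma tri_hull X : exists (B A : C) (u : X ~> B) (v : B ~> A)
  (e : A ~> shift X), [/\ V B, U A & dist u v e].
Proof.
have [A [B [f [g [h [UA VB d]]]]]] := cotorsion_dist cUV (shift X).
have [u eu] := shift_full g; have [v ev] := shift_full h.
exists B, A, (- u), (- v), f; split=> //.
by do 2!apply: dist_unrot; rewrite !fmapN !opprK -eu -ev.
Qed.

(** Perpendicularity: if E(A, V) = 0, the cover triangle of A splits, and A is a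
summand of an object of U. *)
Lemma tri_cotorsion : @cotorsion tri_ext U V.
Proof.
split.
- exact: cotorsion_ext cUV.
- move=> A perpA; have [B [D [u [v [e [VB UD d]]]]]] := tri_cover A.
  rewrite (perpA _ VB e) in d.
  exact: thick_summand (biproduct_sym (split_biproduct d)) UD.
- move=> B perpB; have [D [A [u [v [e [VD UA d]]]]]] := tri_hull B.
  rewrite (perpB _ UA e) in d.
  exact: thick_summand (split_biproduct d) VD.
- exact: tri_cover.
- exact: tri_hull.
- move=> A B f g Wf Wg.
  have [_ sub] := factorsb_zmod_closed (tri_additive C) W A B.
  have /asboolP := sub f g (asboolT Wf) (asboolT Wg); exact.
Qed.

Lemma CplusP X : Cplus U V X <-> @posi tri_ext U X.
Proof.
split=> [[W0 [V0 [f [g [h [[_ VW0] VV0 d]]]]]] A B UA UB x e|].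
  have [y ->] := dist_ker d (cotorsion_ext cUV UA VV0 (g \oc x)).
  by rewrite pushM (cotorsion_ext cUV UB VW0 (push _ e)) push0.
move=> /(posi_cover tri_cotorsion)[B [A [u [v [e [VB WA d]]]]]].
by exists A, B, v, e, (- fmap shift u); split=> //; apply: dist_rot1.
Qed.

(** A triangle U[-1] -> X -> W -> U and a triangle X -> W -> U -> X[1] are
rotations of each other, up to the isomorphism between U and U[-1][1]. *)
Lemma CminusP X : Cminus U V X <-> @nega tri_ext V X.
Proof.
split=> [[U0 [W0 [f [g [h [UU0 [UW0 _] d]]]]]] A B VA VB x e|].
  have [|y ->] := @dist_coker _ _ _ _ _ _ _ x d.
    apply: shift_faithful; have [s [_ s2]] := shift_counit_iso U0.
    rewrite fmap0 -[LHS]compm1 -s2 compmA.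
    by rewrite (cotorsion_ext cUV UU0 VA (_ \oc _)) comp0m.
  change (e \oc (y \oc g) = 0).
  by rewrite compmA (cotorsion_ext cUV UW0 VB (e \oc y)) comp0m.
move=> nX.
have [A [B [u [v [e [UA WB d]]]]]] : exists (A B : C) (u : X ~> B)
    (v : B ~> A) (e : A ~> shift X), [/\ U A, W B & dist u v e].
  have [A [B [v [u [e [UA [VB UB] d]]]]]] :=
    @posi_cover (opExt tri_ext) V U (cotorsion_op tri_cotorsion) X nX.
  by exists A, B, u, v, e.
have [s [s1 s2]] := shift_counit_iso A.
have [f ef] := shift_full (e \oc s).
exists A, B, (- f), u, v; split=> //.
apply: dist_unrot; rewrite fmapN opprK -ef.
apply: (dist_iso (idm_iso _) (idm_iso _) (shift_counit_iso A)) d.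
- by rewrite comp1m compm1.
- by rewrite compm1.
- by rewrite fmap1 comp1m -compmA s1 compm1.
Qed.

End Pair.
End Triangulated.

(** * The heart *)

Section Heart.
Variables (C : triangulatedCat) (U V : thickSubcat C).
Hypothesis cUV : cotorsion_pair U V.

Let H := heart U V.
Let S := tri_ext C.
Let W (X : S) := U X /\ V X.

(** The object of C underlying an object of the heart; the bare first projection
would have the quotient category as its target, where morphisms are classes. *)
Definition hobj (A : H) : C := sval A.

Lemma obj_in_heart (A : H) : @in_heart S U V (hobj A).
Proof.
by have [pA nA] := svalP A; split; [exact/(CplusP cUV) | exact/(CminusP cUV)].
Qed.

Lemma in_heart_obj (X : S) : @in_heart S U V X -> exists A : H, hobj A = X.
Proof.
move=> [pX nX]; have pnX : (Cplus U V `&` Cminus U V)%classic X.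
  by split; [apply/(CplusP cUV) | apply/(CminusP cUV)].
by exists (exist _ X pnX).
Qed.

Definition hproj (A B : H) (f : hobj A ~> hobj B) : A ~> B :=
  quot_proj (tri_additive C) (thickI U V) f.

Lemma hprojM (A B D : H) (g : hobj B ~> hobj D) (f : hobj A ~> hobj B) :
  hproj g \oc hproj f = hproj (g \oc f).
Proof. exact/esym/quot_proj_comp. Qed.

Lemma hprojP (A B : H) (f g : hobj A ~> hobj B) :
  hproj f = hproj g <-> @fact S W _ _ (f - g).
Proof. exact: quot_projP. Qed.

Lemma hprojD (A B : H) (f g : hobj A ~> hobj B) :
  hproj (f + g) = hproj f + hproj g.
Proof. exact: quot_projD. Qed.

Lemma hproj_zero (A B : H) : hproj (0 : hobj A ~> hobj B) = 0.
Proof. by apply: (addrI (hproj 0)); rewrite -hprojD !addr0. Qed.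

Lemma hproj0P (A B : H) (f : hobj A ~> hobj B) :
  hproj f = 0 <-> @fact S W _ _ f.
Proof. by rewrite -hproj_zero hprojP subr0. Qed.

Lemma hproj_surj (A B : H) (f : A ~> B) : exists f', f = hproj f'.
Proof. by exists (generic_quotient.repr f); rewrite /hproj quot_projK. Qed.

Lemma coker_mod_cokernel (A B K : H) (f : hobj A ~> hobj B)
    (k : hobj B ~> hobj K) :
  @coker_mod S U V _ _ _ f k -> is_cokernel (hproj f) (hproj k).
Proof.
move=> [Wkf univ]; split=> [|T g]; first by rewrite hprojM; apply/hproj0P.
have [ex un] := univ _ (obj_in_heart T).
have [{}g ->] := hproj_surj g; rewrite hprojM => /hproj0P/ex[h Wh].
exists (hproj h); split=> [|h']; first by rewrite hprojM; apply/hprojP.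
have [{}h' ->] := hproj_surj h'; rewrite hprojM => eh'.
apply/hprojP/un; rewrite compmBl; apply/hprojP; rewrite eh'.
exact/hprojP.
Qed.

Lemma ker_mod_kernel (A B K : H) (f : hobj A ~> hobj B)
    (k : hobj K ~> hobj A) :
  @ker_mod S U V _ _ _ f k -> is_kernel (hproj f) (hproj k).
Proof.
move=> [Wfk univ]; split=> [|T g]; first by rewrite hprojM; apply/hproj0P.
have [ex un] := univ _ (obj_in_heart T).
have [{}g ->] := hproj_surj g; rewrite hprojM => /hproj0P/ex[h Wh].
exists (hproj h); split=> [|h']; first by rewrite hprojM; apply/hprojP.
have [{}h' ->] := hproj_surj h'; rewrite hprojM => eh'.
apply/hprojP/un; rewrite compmBr; apply/hprojP; rewrite eh'.
exact/hprojP.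
Qed.

Lemma heart_additive : is_additive H.
Proof.
split.
  have [Z Z0] := additive_zero (tri_additive C).
  have [|A eA] := @in_heart_obj Z.
    by split; [apply: posi_zero | apply: nega_zero].
  exists A => T; rewrite -eA in Z0.
  by split=> f; have [{}f ->] := hproj_surj f; rewrite -hproj_zero;
    congr (hproj _); have [z1 z2] := Z0 (hobj T); rewrite ?(z1 f) ?(z2 f).
move=> A B.
have [P bP] := additive_biproduct (tri_additive C) (hobj A) (hobj B).
have [pA nA] := obj_in_heart A; have [pB nB] := obj_in_heart B.
have [|Q eQ] := @in_heart_obj P.
  split; first exact: (@posi_biproduct S U _ _ _ bP).
  exact: (@nega_biproduct S V _ _ _ bP).
rewrite -eQ in bP.
have [i1 [i2 [p1 [p2 [e11 e22 e12 e21 sumP]]]]] := bP.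
exists Q, (hproj i1), (hproj i2), (hproj p1), (hproj p2).
by split; rewrite !hprojM -?hprojD ?e11 ?e22 ?e12 ?e21 ?sumP // hproj_zero.
Qed.

End Heart.

Theorem theorem6p4 (C : triangulatedCat) (U V : thickSubcat C)
  (cUV : cotorsion_pair U V) : is_abelian (heart U V).
Proof.
have cS := tri_cotorsion cUV.
split; first exact: heart_additive.
- move=> A B f; have [{}f ->] := hproj_surj f.
  have [X [k [hX kf]]] := ker_mod_exists cS f
    (obj_in_heart cUV A) (obj_in_heart cUV B).
  have [K eK] := in_heart_obj cUV hX; case: X / eK in k kf hX *.
  by exists K, (hproj k); apply: ker_mod_kernel.
- move=> A B f; have [{}f ->] := hproj_surj f.
  have [X [k [hX kf]]] := coker_mod_exists cS f
    (obj_in_heart cUV A) (obj_in_heart cUV B).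
  have [K eK] := in_heart_obj cUV hX; case: X / eK in k kf hX *.
  by exists K, (hproj k); apply: coker_mod_cokernel.
- move=> A B f; have [{}f ->] := hproj_surj f => monof.
  have [|X [k [hX kf]]] := mono_normal cS (f := f)
    (obj_in_heart cUV A) (obj_in_heart cUV B).
    move=> T hT h Wh; have [T' eT] := in_heart_obj cUV hT.
    case: T / eT in h Wh hT *; apply/hproj0P/monof.
    by rewrite compm0 hprojM; apply/hproj0P.
  have [K eK] := in_heart_obj cUV hX; case: X / eK in k kf hX *.
  by exists K, (hproj k); apply: ker_mod_kernel.
- move=> A B f; have [{}f ->] := hproj_surj f => epif.
  have [|X [k [hX kf]]] := epi_normal cS (f := f)
    (obj_in_heart cUV A) (obj_in_heart cUV B).
    move=> T hT h Wh; have [T' eT] := in_heart_obj cUV hT.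
    case: T / eT in h Wh hT *; apply/hproj0P/epif.
    by rewrite comp0m hprojM; apply/hproj0P.
  have [K eK] := in_heart_obj cUV hX; case: X / eK in k kf hX *.
  by exists K, (hproj k); apply: coker_mod_cokernel.
Qed.
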